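(* Let $\Gamma_V$ be the geometry obtained from a split simply connected group $G$ over $k$ and a nontrivial irreducible representation $V$ of $G$ as described in the context, let $n$ be the rank of $G$, let $\phi$ be an automorphism of $G$, and let $\psi\colon \Gamma_V \to \mathrm{SubSp}(V)$ be a function, where $\mathrm{SubSp}(V)$ denotes the collection of subspaces of $V$. Suppose that (1) $\psi(gX) = \phi(g)\,\psi(X)$ for every $X \in \Gamma_V$ and every $g \in G(k)$, and (2) there is a chamber $\{V_i \mid 1 \le i \le n\}$ such that $\{\psi(V_i) \mid 1 \le i \le n\}$ is also a chamber. Then $\psi$ is the automorphism of the geometry $\Gamma_V$ induced by the automorphism $\phi$ of $G$.
   Context: $k$ is a field of characteristic zero. $G$ is the split simply connected semisimple algebraic group over $k$ with a given reduced root system; fix a Borel subgroup $B$ and a split maximal torus $T \subset B$, with set of simple roots $\Delta$. For $\delta \in \Delta$, $P_\delta$ is the standard maximal proper parabolic subgroup corresponding to $\delta$, i.e. the subgroup generated by $B$ and the root subgroups for $-\alpha$ with $\alpha \in \Delta \setminus \{\delta\}$. Every maximal proper parabolic subgroup of $G$ is $G(k)$-conjugate to a unique $P_\delta$; $\delta$ is called its type. An incidence geometry is a set of objects, each with a type, with a reflexive symmetric relation (incidence) such that objects of the same type are incident if and only if they are equal. The geometry $\Gamma_P$ has as objects the maximal proper parabolic subgroups of $G$; two are incident if their intersection contains a parabolic subgroup of $G$. The geometry $\Gamma_V$: $V$ is a finite-dimensional nontrivial irreducible representation of $G$. For each $\delta\in\Delta$ a nonzero proper $P_\delta$-invariant subspace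 $V_\delta \subset V$ is chosen (assumed to exist). For a maximal proper parabolic $P' = gP_\delta g^{-1}$ with $g \in G(k)$, put $V_{P'} := gV_\delta$ (this is well defined, and its stabilizer in $G$ is $P'$). The objects of $\Gamma_V$ are the subspaces $V_{P'}$; the map $P' \mapsto V_{P'}$ is a bijection from $\Gamma_P$ to $\Gamma_V$, and type and incidence in $\Gamma_V$ are transported from $\Gamma_P$ via this bijection. A chamber is a collection $\{X_\delta \mid \delta\in\Delta\}$ of pairwise incident objects of $\Gamma_V$ with $X_\delta$ of type $\delta$ (one for each $\delta\in\Delta$). An automorphism $\phi$ of $G$ permutes the maximal proper parabolic subgroups and so induces an automorphism of $\Gamma_P$ (types may be permuted); the induced automorphism of $\Gamma_V$ is $V_{P'} \mapsto V_{\phi(P')}$. *)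

(* Defs.v *)
From HB Require Import structures.
From mathcomp Require Import all_boot all_order all_algebra.
From mathcomp Require Import mpoly.

Set Implicit Arguments.
Unset Strict Implicit.
Unset Printing Implicit Defensive.

Import GRing.Theory.
Local Open Scope ring_scope.

(* Linear algebraic groups are treated in the classical language (Borel,
   Humphreys, Springer): K is an algebraically closed extension of the ground
   field k (via iota), a group is the set of its K-points, a Zariski closed
   subgroup of some GL_N(K), and "over k" means cut out by, resp. given by,
   polynomials with coefficients in k.  In characteristic zero all algebraic
   groups are reduced, so nothing is lost in passing to K-points. *)

Section Varieties.

Variables (F L : fieldType) (iota : {rmorphism F -> L}).

Definition mxcoord (R : fieldType) N (g : 'M[R]_N) : 'I_(N * N) -> R :=
  fun l => mxvec g 0 l.

(* An M x M matrix of elements of F[GL_N] = F[x_ij][1/det], written with a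
   common denominator det^dexp. *)
Record regmap (N M : nat) := RegMap {
  num : 'M[{mpoly F[N * N]}]_M;
  dexp : nat
}.

Definition regeval N M (f : regmap N M) (g : 'M[L]_N) : 'M[L]_M :=
  (\det g)^-1 ^+ dexp f *: map_mx (mmap iota (mxcoord g)) (num f).

Definition GL N (g : 'M[L]_N) : Prop := g \in unitmx.

Definition closed_over N (S : 'M[L]_N -> Prop) : Prop :=
  exists I : {mpoly F[N * N]} -> Prop, forall g : 'M[L]_N,
    S g <-> g \in unitmx /\ forall p, I p -> mmap iota (mxcoord g) p = 0.

Definition subset_of N (S1 S2 : 'M[L]_N -> Prop) := forall g, S1 g -> S2 g.
Definition same_set N (S1 S2 : 'M[L]_N -> Prop) := forall g, S1 g <-> S2 g.

Definition subgroup N (S : 'M[L]_N -> Prop) : Prop :=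
  [/\ subset_of S (@GL N),
      S 1%:M,
      forall g h, S g -> S h -> S (g *m h) &
      forall g, S g -> S (invmx g)].

Definition alg_subgroup N (S : 'M[L]_N -> Prop) : Prop :=
  subgroup S /\ closed_over S.

Definition alg_hom N M (S1 : 'M[L]_N -> Prop) (S2 : 'M[L]_M -> Prop)
    (f : regmap N M) : Prop :=
  (forall g, S1 g -> S2 (regeval f g)) /\
  (forall g h, S1 g -> S1 h ->
     regeval f (g *m h) = regeval f g *m regeval f h).

Definition alg_iso N M (S1 : 'M[L]_N -> Prop) (S2 : 'M[L]_M -> Prop)
    (f : regmap N M) : Prop :=
  alg_hom S1 S2 f /\
  exists h : regmap M N,
    [/\ forall g, S2 g -> S1 (regeval h g),
        forall g, S1 g -> regeval h (regeval f g) = g &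
        forall g, S2 g -> regeval f (regeval h g) = g].

(* G_m^r, as the diagonal subgroup of GL_r *)
Definition Gm_pow r (g : 'M[L]_r) : Prop :=
  exists s : 'rV[L]_r, (forall i, s 0 i != 0) /\ g = diag_mx s.

(* tau is an isomorphism over F from G_m^r onto T *)
Definition split_torus r N (T : 'M[L]_N -> Prop) (tau : regmap r N) : Prop :=
  alg_subgroup T /\ alg_iso (@Gm_pow r) T tau.

Definition generated N (A : 'M[L]_N -> Prop) (g : 'M[L]_N) : Prop :=
  forall H, subgroup H -> subset_of A H -> H g.

Definition commutators N (S : 'M[L]_N -> Prop) (x : 'M[L]_N) : Prop :=
  exists g h, [/\ S g, S h & x = invmx g *m invmx h *m g *m h].

Definition derived N (S : 'M[L]_N -> Prop) := generated (commutators S).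

Definition trivial_group N (S : 'M[L]_N -> Prop) := forall g, S g -> g = 1%:M.

Definition solvable N (S : 'M[L]_N -> Prop) : Prop :=
  exists m, trivial_group (iter m (@derived N) S).

Definition normal_in N (S G : 'M[L]_N -> Prop) : Prop :=
  subset_of S G /\ forall g x, G g -> S x -> S (g *m x *m invmx g).

Definition conj_set N (g : 'M[L]_N) (S : 'M[L]_N -> Prop) (x : 'M[L]_N) : Prop :=
  exists2 y, S y & x = g *m y *m invmx g.

Definition morph_image N M (f : regmap N M) (S : 'M[L]_N -> Prop) (x : 'M[L]_M) : Prop :=
  exists2 y, S y & x = regeval f y.

End Varieties.

Section Geometric.

Variable K : closedFieldType.

Definition zclosed N (S : 'M[K]_N -> Prop) :=
  closed_over (idfun : {rmorphism K -> K}) S.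

Definition zclosed_subgroup N (S : 'M[K]_N -> Prop) :=
  alg_subgroup (idfun : {rmorphism K -> K}) S.

Definition connected N (S : 'M[K]_N -> Prop) : Prop :=
  forall A1 A2, zclosed A1 -> zclosed A2 ->
    (forall g, S g -> A1 g \/ A2 g) ->
    (forall g, S g -> A1 g -> A2 g -> False) ->
    subset_of S A1 \/ subset_of S A2.

(* the algebraic subgroup generated by A *)
Definition zgenerated N (A : 'M[K]_N -> Prop) (g : 'M[K]_N) : Prop :=
  forall H, zclosed_subgroup H -> subset_of A H -> H g.

Definition torus N (T : 'M[K]_N -> Prop) : Prop :=
  exists r (tau : regmap K r N), split_torus (idfun : {rmorphism K -> K}) T tau.

Definition maximal_torus N (G T : 'M[K]_N -> Prop) : Prop :=
  [/\ torus T, subset_of T G &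
      forall S, torus S -> subset_of S G -> subset_of T S -> subset_of S T].

Definition semisimple N (G : 'M[K]_N -> Prop) : Prop :=
  [/\ zclosed_subgroup G, connected G &
      forall R, zclosed_subgroup R -> connected R -> solvable R ->
        normal_in R G -> trivial_group R].

(* Every isogeny onto G from a connected group is an isomorphism; in
   characteristic zero the kernel of such an isogeny is central. *)
Definition simply_connected N (G : 'M[K]_N -> Prop) : Prop :=
  forall M (H : 'M[K]_M -> Prop) (f : regmap K M N),
    zclosed_subgroup H -> connected H ->
    alg_hom (idfun : {rmorphism K -> K}) H G f ->
    (forall g, G g -> exists2 h, H h & regeval (idfun : {rmorphism K -> K}) f h = g) ->
    (exists l : seq 'M[K]_M, forall h, H h ->
       regeval (idfun : {rmorphism K -> K}) f h = 1%:M -> h \in l) ->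
    alg_iso (idfun : {rmorphism K -> K}) H G f.

Definition borel N (G B : 'M[K]_N -> Prop) : Prop :=
  [/\ zclosed_subgroup B, connected B, solvable B, subset_of B G &
      forall S, zclosed_subgroup S -> connected S -> solvable S ->
        subset_of S G -> subset_of B S -> subset_of S B].

(* Lie algebra, as the Zariski tangent space at 1 *)
Definition lie N (G : 'M[K]_N -> Prop) (X : 'M[K]_N) : Prop :=
  forall p : {mpoly K[N * N]},
    (forall g, G g -> p.@[mxcoord g] = 0) ->
    \sum_(l < N * N) (p^`M(l)).@[mxcoord (1%:M : 'M[K]_N)] * mxcoord X l = 0.

End Geometric.

Section SplitGroups.

Variables (k : fieldType) (K : closedFieldType) (iota : {rmorphism k -> K}).

Section Roots.

Variables (N n : nat) (G : 'M[K]_N -> Prop) (tau : regmap k n N).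

(* Characters of the split torus are identified, through tau, with integer
   vectors: the vector a is the character tau (s) |-> prod_i s_i ^ a_i. *)
Definition char_val (a : 'rV[int]_n) (s : 'rV[K]_n) : K :=
  \prod_(i < n) s 0 i ^ a 0 i.

Definition torus_pt (s : 'rV[K]_n) : 'M[K]_N := regeval iota tau (diag_mx s).

Definition is_root (a : 'rV[int]_n) : Prop :=
  a != 0 /\
  exists X : 'M[K]_N, [/\ X != 0, lie G X &
    forall s : 'rV[K]_n, (forall i, s 0 i != 0) ->
      torus_pt s *m X *m invmx (torus_pt s) = char_val a s *: X].

Definition Ga_eval (x : 'M[{poly k}]_N) (c : K) : 'M[K]_N :=
  map_mx (fun p => (map_poly iota p).[c]) x.

(* x is an isomorphism over k from G_a onto a subgroup of G normalized by the
   torus, on which the torus acts through a.  The image of x has determinant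
   one, so its regular functions are polynomials in the matrix entries. *)
Definition root_hom (a : 'rV[int]_n) (x : 'M[{poly k}]_N) : Prop :=
  [/\ forall c, G (Ga_eval x c),
      forall c c', Ga_eval x (c + c') = Ga_eval x c *m Ga_eval x c',
      exists q : {mpoly k[N * N]},
        forall c, mmap iota (mxcoord (Ga_eval x c)) q = c &
      forall (s : 'rV[K]_n) c, (forall i, s 0 i != 0) ->
        torus_pt s *m Ga_eval x c *m invmx (torus_pt s)
        = Ga_eval x (char_val a s * c)].

(* For a root a of a split semisimple group, root homomorphisms exist and are
   unique up to scaling the parameter, hence all have the same image. *)
Definition root_group (a : 'rV[int]_n) (g : 'M[K]_N) : Prop :=
  exists (x : 'M[{poly k}]_N) (c : K), root_hom a x /\ g = Ga_eval x c.

Definition positive (Delta : 'I_n -> 'rV[int]_n) (a : 'rV[int]_n) : Prop :=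
  is_root a /\ exists c : 'I_n -> nat, a = \sum_(i < n) Delta i *+ c i.

Definition root_base (Delta : 'I_n -> 'rV[int]_n) : Prop :=
  [/\ forall i, is_root (Delta i),
      forall c : 'I_n -> int, \sum_(i < n) Delta i *~ c i = 0 -> forall i, c i = 0 &
      forall a, is_root a -> positive Delta a \/ positive Delta (- a)].

(* Delta is the base of the root system attached to the pair T <= B: under
   the bijection between bases (or systems of positive roots) and Borel
   subgroups containing T, the Borel subgroup corresponding to Delta is the
   one generated by T and the root subgroups of the positive roots. *)
Definition simple_roots_of (B T : 'M[K]_N -> Prop)
    (Delta : 'I_n -> 'rV[int]_n) : Prop :=
  root_base Delta /\
  same_set B (zgenerated (fun g =>
    T g \/ exists2 a, positive Delta a & root_group a g)).

Definition std_parabolic (B : 'M[K]_N -> Prop) (Delta : 'I_n -> 'rV[int]_n)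
    (i : 'I_n) : 'M[K]_N -> Prop :=
  zgenerated (fun g => B g \/ exists2 j, j != i & root_group (- Delta j) g).

End Roots.

Section Parabolics.

Variables (N : nat) (G : 'M[K]_N -> Prop).

Definition parabolic (P : 'M[K]_N -> Prop) : Prop :=
  [/\ alg_subgroup iota P, subset_of P G & exists2 B, borel G B & subset_of B P].

Definition max_parabolic (P : 'M[K]_N -> Prop) : Prop :=
  [/\ parabolic P, ~ subset_of G P &
      forall Q, parabolic Q -> ~ subset_of G Q -> subset_of P Q -> subset_of Q P].

Definition incident_P (P Q : 'M[K]_N -> Prop) : Prop :=
  exists2 R, parabolic R & subset_of R P /\ subset_of R Q.

Definition kpoint (g : 'M[k]_N) : Prop := G (map_mx iota g).

End Parabolics.

(* The representation space is V = k^d, as column vectors. *)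
Section Representations.

Variables (N d : nat) (G : 'M[K]_N -> Prop) (rho : regmap k N d).

Definition mx_act (R : fieldType) (A : 'M[R]_d) (W : {vspace 'cV[R]_d}) :
    {vspace 'cV[R]_d} :=
  (linfun (mulmx A) @: W)%VS.

Definition extend (W : {vspace 'cV[k]_d}) : {vspace 'cV[K]_d} :=
  <<[seq map_mx iota w | w <- vbasis W]>>%VS.

(* Invariance under a group P over k: P(K) stabilizes W (x) K. *)
Definition stabilized_by (P : 'M[K]_N -> Prop) (W : {vspace 'cV[k]_d}) : Prop :=
  forall g, P g -> (mx_act (regeval iota rho g) (extend W) <= extend W)%VS.

Definition representation : Prop := alg_hom iota G (@GL K d) rho.

Definition irreducible_rep : Prop :=
  (0 < d)%N /\
  forall W : {vspace 'cV[k]_d}, stabilized_by G W -> W = 0%VS \/ W = fullv.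

Definition nontrivial_rep : Prop := exists2 g, G g & regeval iota rho g != 1%:M.

(* the action of GL_N(k), in particular of G(k), on the subspaces of V *)
Definition gact (g : 'M[k]_N) (W : {vspace 'cV[k]_d}) : {vspace 'cV[k]_d} :=
  mx_act (regeval (idfun : {rmorphism k -> k}) rho g) W.

Section Geometry.

Variables (n : nat) (Pst : 'I_n -> ('M[K]_N -> Prop)).
Variable Vst : 'I_n -> {vspace 'cV[k]_d}.

(* "P' is a maximal proper parabolic of type i and X = V_P'".  The subspace
   V_P' is determined by P', so V_P' is used through its graph. *)
Definition is_V_typed (i : 'I_n) (P' : 'M[K]_N -> Prop) (X : {vspace 'cV[k]_d}) :
    Prop :=
  max_parabolic G P' /\
  exists g : 'M[k]_N, [/\ kpoint G g,
    same_set P' (conj_set (map_mx iota g) (Pst i)) & X = gact g (Vst i)].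

Definition is_V (P' : 'M[K]_N -> Prop) (X : {vspace 'cV[k]_d}) : Prop :=
  exists i, is_V_typed i P' X.

Definition Gamma_V (X : {vspace 'cV[k]_d}) : Prop := exists P', is_V P' X.

Definition has_type (i : 'I_n) (X : {vspace 'cV[k]_d}) : Prop :=
  exists P', is_V_typed i P' X.

Definition incident_V (X Y : {vspace 'cV[k]_d}) : Prop :=
  exists P' Q', [/\ is_V P' X, is_V Q' Y & incident_P G P' Q'].

Definition chamber (C : {vspace 'cV[k]_d} -> Prop) : Prop :=
  exists X : 'I_n -> {vspace 'cV[k]_d},
    [/\ forall i, has_type i (X i),
        forall i j, incident_V (X i) (X j) &
        forall Y, C Y <-> exists i, Y = X i].

(* psi is the map V_P' |-> V_phi(P') *)
Definition induced_by (phi : regmap k N N)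
    (psi : {vspace 'cV[k]_d} -> {vspace 'cV[k]_d}) : Prop :=
  forall P' X, is_V P' X -> is_V (morph_image iota phi P') (psi X).

End Geometry.

End Representations.

End SplitGroups.

(* Main.v *)
Require Import Defs.
From HB Require Import structures.
From mathcomp Require Import all_boot all_order all_algebra.
From mathcomp Require Import mpoly.
From Stdlib Require Import FunctionalExtensionality PropExtensionality.

Set Implicit Arguments.
Unset Strict Implicit.
Unset Printing Implicit Defensive.

Import GRing.Theory.
Local Open Scope ring_scope.

(* Since G(k) acts transitively on the objects of each type, it is enough to
   treat the base object V_i, with stabilizer P_i.  Condition (2) gives
   psi(V_i) = u V_j for some j and some u in G(k), and by (1) the group
   phi(P_i(k)) stabilizes u V_j.  A stabilizer of a proper nonzero subspace is a
   proper closed subgroup defined over k, so it equals any maximal parabolic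
   subgroup that it contains; hence P_j is the stabilizer of V_j and
   phi(P_i(k)) lies in Q = u P_j u^-1.  As P_i is generated by images of G_m and
   G_a under maps defined over the infinite field k, P_i(k) is Zariski dense in
   P_i, so P_i lies in phi^-1(Q), and P_i = phi^-1(Q) by maximality. *)

(** * Regular functions and closed sets *)

(** Extensionality turns pointwise equivalence into an equality, so that groups can be rewritten. *)
Lemma same_setE (L : fieldType) N (S1 S2 : 'M[L]_N -> Prop) :
  same_set S1 S2 -> S1 = S2.
Proof.
by move=> eqS; apply: functional_extensionality => g; apply: propositional_extensionality.
Qed.

Section RegularFunctions.

Variables (F L : fieldType) (iota : {rmorphism F -> L}).

(** Only the values on invertible matrices are constrained, since the denominator is a power of the
    determinant. *)
Definition regular N (f : 'M[L]_N -> L) : Prop :=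
  exists (q : {mpoly F[N * N]}) (e : nat), forall g, g \in unitmx ->
    f g = (\det g)^-1 ^+ e * mmap iota (mxcoord g) q.

Definition regular_mx N M (f : 'M[L]_N -> 'M[L]_M) : Prop :=
  forall i j, regular (fun g => f g i j).

Definition genericmx N : 'M[{mpoly F[N * N]}]_N := \matrix_(i, j) 'X_(mxvec_index i j).

Lemma mmap_genericmx N (g : 'M[L]_N) : map_mx (mmap iota (mxcoord g)) (genericmx N) = g.
Proof. by apply/matrixP=> i j; rewrite !mxE mmapX mmap1U /mxcoord mxvecE. Qed.

Lemma eq_regular N (f f' : 'M[L]_N -> L) :
  (forall g, g \in unitmx -> f g = f' g) -> regular f' -> regular f.
Proof. by move=> eqf [q [e Hq]]; exists q, e => g gu; rewrite eqf ?Hq. Qed.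

Lemma regular_const N c : regular (fun _ : 'M[L]_N => iota c).
Proof. by exists c%:MP, 0%N => g _; rewrite mmapC mul1r. Qed.

Lemma regular_coord N i j : regular (fun g : 'M[L]_N => g i j).
Proof.
by exists 'X_(mxvec_index i j), 0%N => g _; rewrite mmapX mmap1U /mxcoord mxvecE mul1r.
Qed.

Lemma regular_mul N (f f' : 'M[L]_N -> L) :
  regular f -> regular f' -> regular (fun g => f g * f' g).
Proof.
move=> [q [e Hq]] [q' [e' Hq']]; exists (q * q'), (e + e')%N => g gu.
by rewrite Hq // Hq' // rmorphM exprD mulrACA.
Qed.

Lemma regular_add N (f f' : 'M[L]_N -> L) :
  regular f -> regular f' -> regular (fun g => f g + f' g).
Proof.
move=> [q [e Hq]] [q' [e' Hq']].
(* Both fractions are brought to the denominator det^(e + e'); the determinant of the generic matrix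
   is det as a polynomial. *)
exists (\det (genericmx N) ^+ e' * q + \det (genericmx N) ^+ e * q'), (e + e')%N => g gu.
have det0 : \det g != 0 by rewrite -unitfE -unitmxE.
rewrite Hq // Hq' // rmorphD !rmorphM !rmorphXn /= -!det_map_mx mmap_genericmx.
have detV e0 : (\det g)^-1 ^+ e0 * \det g ^+ e0 = 1.
  by rewrite -exprMn mulVf // expr1n.
rewrite exprD mulrDr !mulrA; congr (_ + _).
  by rewrite -(mulrA _ _ (_ ^+ e')) detV mulr1.
by rewrite (mulrC (_ ^+ e)) -(mulrA _ _ (_ ^+ e)) detV mulr1.
Qed.

Lemma regular_sum N (I : Type) (r : seq I) (f : I -> 'M[L]_N -> L) :
  (forall i, regular (f i)) -> regular (fun g => \sum_(i <- r) f i g).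
Proof.
move=> regf; elim: r => [|i r IHr].
  apply: (@eq_regular _ _ (fun=> iota 0)); last exact: regular_const.
  by move=> g _; rewrite big_nil rmorph0.
apply: eq_regular (regular_add (regf i) IHr) => g _; exact: big_cons.
Qed.

Lemma regular_prod N (I : Type) (r : seq I) (f : I -> 'M[L]_N -> L) :
  (forall i, regular (f i)) -> regular (fun g => \prod_(i <- r) f i g).
Proof.
move=> regf; elim: r => [|i r IHr].
  apply: (@eq_regular _ _ (fun=> iota 1)); last exact: regular_const.
  by move=> g _; rewrite big_nil rmorph1.
apply: eq_regular (regular_mul (regf i) IHr) => g _; exact: big_cons.
Qed.

Lemma regular_exp N (f : 'M[L]_N -> L) e : regular f -> regular (fun g => f g ^+ e).
Proof.
move=> regf; apply: eq_regular (regular_prod (seq.iota 0 e) (fun=> regf)) => g _.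
rewrite big_const_seq count_predT size_iota.
by elim: e => [|e IHe] /=; rewrite ?expr0 // exprS IHe.
Qed.

Lemma regular_mx_id N : regular_mx (fun g : 'M[L]_N => g).
Proof. by move=> i j; apply: regular_coord. Qed.

Lemma regular_mx_const N M (A : 'M[F]_M) :
  regular_mx (fun _ : 'M[L]_N => map_mx iota A).
Proof.
move=> i j; apply: eq_regular (regular_const _ (A i j)) => g _; exact: mxE.
Qed.

Lemma regular_mx_mul N M (f f' : 'M[L]_N -> 'M[L]_M) :
  regular_mx f -> regular_mx f' -> regular_mx (fun g => f g *m f' g).
Proof.
move=> regf regf' i j.
apply: (@eq_regular _ _ (fun g => \sum_l f g i l * f' g l j)).
  by move=> g _; rewrite mxE.
by apply: regular_sum => l; apply: regular_mul.
Qed.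

Lemma regular_mx_eval N M (f : regmap F N M) :
  regular_mx (fun g : 'M[L]_N => regeval iota f g).
Proof. by move=> i j; exists (num f i j), (dexp f) => g _; rewrite !mxE. Qed.

Lemma regular_poly N M (f : 'M[L]_N -> 'M[L]_M) (p : {mpoly F[M * M]}) :
  regular_mx f -> regular (fun g => mmap iota (mxcoord (f g)) p).
Proof.
move=> regf; apply: regular_sum => m; apply: regular_mul; first exact: regular_const.
apply: regular_prod => l; apply: regular_exp.
apply: eq_regular (regf (mxvec_indexP l).1 (mxvec_indexP l).2) => g _.
by rewrite /mxcoord; case/mxvec_indexP: l => i j; rewrite mxvecE.
Qed.

(** Denominators can be cleared: det is nonzero on invertible matrices, so a regular function
    vanishes exactly where its numerator does. The polynomial equations chosen are all numerators of
    members of [J]. *)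
Lemma closed_over_regular N (J : ('M[L]_N -> L) -> Prop) (S : 'M[L]_N -> Prop) :
  (forall f, J f -> regular f) ->
  (forall g, S g <-> g \in unitmx /\ forall f, J f -> f g = 0) ->
  closed_over iota S.
Proof.
move=> regJ SJ.
exists (fun q => exists f e, J f /\ forall g, g \in unitmx ->
    f g = (\det g)^-1 ^+ e * mmap iota (mxcoord g) q) => g.
rewrite SJ; split=> -[gu Z]; split=> //.
  move=> q [f [e [Jf fE]]]; apply/eqP.
  have: f g == 0 by rewrite Z.
  by rewrite fE // mulf_eq0 expf_eq0 invr_eq0 -[\det g == 0]negbK -unitfE
    -unitmxE gu andbF.
by move=> f Jf; have [q [e fE]] := regJ f Jf; rewrite fE // (Z q) ?mulr0 //; exists f, e.
Qed.

Lemma closed_preimage N M (G : 'M[L]_N -> Prop) (S : 'M[L]_M -> Prop) f :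
  closed_over iota G -> closed_over iota S -> regular_mx f ->
  (forall g, G g -> f g \in unitmx) ->
  closed_over iota (fun g => G g /\ S (f g)).
Proof.
move=> [I GI] [J SJ] regf fu.
(* The equations are those of [G] together with the pullbacks along [f] of those of [S]. *)
pose K h := (exists2 p, I p & h = fun g => mmap iota (mxcoord g) p) \/
            (exists2 p, J p & h = fun g => mmap iota (mxcoord (f g)) p).
apply: (@closed_over_regular _ K).
  move=> h [] [p _ ->]; apply: regular_poly => //; exact: regular_mx_id.
move=> g; split=> [[Gg Sfg]|[gu Z]].
  have [gu Z] := (GI g).1 Gg; split=> // h [] [p Kp ->]; first exact: Z.
  by have [_ ->] := (SJ _).1 Sfg.
have Gg : G g.
  apply/GI; split=> // p Ip.
  by apply: (Z (fun g => mmap iota (mxcoord g) p)); left; exists p.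
split=> //; apply/SJ; split; first exact: fu.
by move=> p Jp; apply: (Z (fun g => mmap iota (mxcoord (f g)) p)); right; exists p.
Qed.

Lemma closed_GL N : closed_over iota (@GL L N).
Proof. by exists (fun=> False) => g; split=> [gu|[]]. Qed.

End RegularFunctions.

(** * Base change and stable subspaces *)

Section BaseChange.

Variables (F L : fieldType) (iota : {rmorphism F -> L}).

(** This is the passage between [phi] and [rho] on rational points and the same maps on K-points. *)
Lemma map_regeval N M (f : regmap F N M) (g : 'M[F]_N) :
  map_mx iota (regeval (idfun : {rmorphism F -> F}) f g) =
  regeval iota f (map_mx iota g).
Proof.
rewrite /regeval map_mxZ rmorphXn /= fmorphV -det_map_mx; congr (_ *: _).
apply/matrixP=> i j; rewrite !mxE /mmap rmorph_sum; apply: eq_bigr => m _.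
rewrite rmorphM /mmap1 rmorph_prod; congr (_ * _); apply: eq_bigr => l _.
by rewrite rmorphXn /mxcoord -map_mxvec mxE.
Qed.

Lemma mmap_map_mpoly n (h : 'I_n -> L) (p : {mpoly F[n]}) :
  mmap (idfun : {rmorphism L -> L}) h (map_mpoly iota p) = mmap iota h p.
Proof.
rewrite [p in LHS]mpolyE (raddf_sum (map_mpoly iota)) raddf_sum [RHS]/mmap.
apply: eq_bigr => m _ /=.
by rewrite map_mpolyZ map_mpolyX mmapZ mmapX.
Qed.

Lemma closed_base_change N (S : 'M[L]_N -> Prop) :
  closed_over iota S -> closed_over (idfun : {rmorphism L -> L}) S.
Proof.
move=> [I SI]; exists (fun q => exists2 p, I p & q = map_mpoly iota p) => g.
rewrite SI; split=> -[gu Z]; split=> //.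
  by move=> q [p Ip ->]; rewrite mmap_map_mpoly Z.
by move=> p Ip; rewrite -mmap_map_mpoly Z //; exists p.
Qed.

Lemma alg_subgroup_base_change N (S : 'M[L]_N -> Prop) :
  alg_subgroup iota S -> alg_subgroup (idfun : {rmorphism L -> L}) S.
Proof. by move=> [Sg /closed_base_change]. Qed.

End BaseChange.

(** * Stability of a subspace as a matrix identity *)

Section Action.

Variables (R : fieldType) (d : nat).
Implicit Types (A B Q : 'M[R]_d) (W : {vspace 'cV[R]_d}).

Lemma mx_actM A B W : mx_act A (mx_act B W) = mx_act (A *m B) W.
Proof.
rewrite /mx_act -limg_comp; congr (_ @: _)%VS; apply/lfunP => v.
by rewrite comp_lfunE !lfunE /= mulmxA.
Qed.

Lemma mx_act1 W : mx_act 1%:M W = W.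
Proof.
rewrite /mx_act -[RHS]lim1g; congr (_ @: _)%VS; apply/lfunP => v.
by rewrite !lfunE /= mul1mx.
Qed.

Lemma mx_actK A W : A \in unitmx -> mx_act (invmx A) (mx_act A W) = W.
Proof. by move=> Au; rewrite mx_actM mulVmx // mx_act1. Qed.

Lemma dim_mx_act A W : A \in unitmx -> \dim (mx_act A W) = \dim W.
Proof.
move=> Au; rewrite limg_dim_eq // (eqP (_ : lker _ == 0%VS)) ?capv0 //.
apply/lker0P => u v; rewrite !lfunE /= => /(congr1 (mulmx (invmx A))).
by rewrite !mulmxA mulVmx // !mul1mx.
Qed.

Lemma mx_act_stable A W : A \in unitmx -> (mx_act A W <= W)%VS -> mx_act A W = W.
Proof. by move=> Au AW; apply/eqP; rewrite eqEdim AW dim_mx_act /=. Qed.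

(** For idempotent [Q] this is the image of [Q]. Presenting subspaces by idempotents makes stability
    an equation between matrices, which behaves well under field extension. *)
Definition fixmx Q : {vspace 'cV[R]_d} := fixedSpace (linfun (mulmx Q)).

Lemma fixmxP Q v : reflect (Q *m v = v) (v \in fixmx Q).
Proof. by apply: (iffP fixedSpaceP); rewrite lfunE. Qed.

(** The subspace consists of the vectors Qv, so stability says that [Q] fixes every AQv; testing on
    the standard basis gives the matrix identity. *)
Lemma fixmx_stable A Q : Q *m Q = Q ->
  (mx_act A (fixmx Q) <= fixmx Q)%VS <-> Q *m A *m Q = A *m Q.
Proof.
move=> QQ; split=> [/subvP AQ | QAQ]; last first.
  apply/subvP => _ /memv_imgP[v /fixmxP Qv ->]; rewrite lfunE /=; apply/fixmxP.
  by rewrite -Qv (mulmxA A) mulmxA (mulmxA Q) QAQ.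
apply/matrixP => i j.
suff /colP/(_ i) : Q *m A *m Q *m delta_mx j (0 : 'I_1) = A *m Q *m delta_mx j 0.
  by rewrite -!colE !mxE.
rewrite -(mulmxA _ _ (delta_mx _ _)) -(mulmxA A) -mulmxA; apply/fixmxP/AQ/memv_imgP.
exists (Q *m delta_mx j 0); last by rewrite lfunE.
by apply/fixmxP; rewrite mulmxA QQ.
Qed.

Definition projmx W : 'M[R]_d := \matrix_(i, j) projv W (delta_mx j 0) i 0.

Lemma mul_projmx W v : projmx W *m v = projv W v.
Proof.
apply/colP=> i; rewrite [v in RHS]matrix_sum_delta linear_sum summxE mxE.
by apply: eq_bigr => j _; rewrite big_ord1 linearZ !mxE mulrC.
Qed.

Lemma col_projmx W j : col j (projmx W) = projv W (delta_mx j 0).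
Proof. by rewrite colE mul_projmx. Qed.

Lemma projmx_idem W : projmx W *m projmx W = projmx W.
Proof.
apply/matrixP => i j.
suff /colP/(_ i) : col j (projmx W *m projmx W) = col j (projmx W) by rewrite !mxE.
by rewrite {1}colE -mulmxA -colE col_projmx mul_projmx projv_proj.
Qed.

Lemma fixmx_proj W : fixmx (projmx W) = W.
Proof.
apply/vspaceP => v; apply/fixmxP/idP; rewrite mul_projmx; last exact: projv_id.
by move=> <-; exact: memv_proj.
Qed.

End Action.

Section Extension.

Variables (k : fieldType) (K : closedFieldType) (iota : {rmorphism k -> K}).
Variable d : nat.
Implicit Types (A : 'M[k]_d) (W : {vspace 'cV[k]_d}).

Lemma memv_extend W w : w \in W -> map_mx iota w \in extend iota W.
Proof.
move=> Ww; rewrite (coord_vbasis Ww) raddf_sum; apply: memv_suml => i _ /=.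
by rewrite map_mxZ; apply: memvZ; apply/memv_span/map_f/mem_nth; rewrite size_tuple.
Qed.

(** Any v fixed by the extended projection is a combination of its columns, and these are images
    under [iota] of vectors of [W]. *)
Lemma extend_fixmx W : extend iota W = fixmx (map_mx iota (projmx W)).
Proof.
apply: subv_anti; apply/andP; split.
  apply/span_subvP => _ /mapP[w /vbasis_mem Ww ->]; apply/fixmxP.
  by rewrite -map_mxM mul_projmx projv_id.
apply/subvP => v /fixmxP <-.
rewrite [v]matrix_sum_delta mulmx_sumr; apply: memv_suml => j _.
rewrite big_ord1 -scalemxAr memvZ // -colE -map_col col_projmx.
exact/memv_extend/memv_proj.
Qed.

Lemma extend_stable (A : 'M[K]_d) W :
  let Q := map_mx iota (projmx W) in
  (mx_act A (extend iota W) <= extend iota W)%VS <-> Q *m A *m Q = A *m Q.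
Proof.
by move=> Q; rewrite extend_fixmx; apply: fixmx_stable; rewrite -map_mxM projmx_idem.
Qed.

(** Both sides are the same identity between matrices over [k], read before and after the injective
    map [iota]. *)
Lemma extend_stable_map A W :
  (mx_act (map_mx iota A) (extend iota W) <= extend iota W)%VS <->
  (mx_act A W <= W)%VS.
Proof.
rewrite extend_stable -!map_mxM -[X in mx_act A X]fixmx_proj.
rewrite -[X in (_ <= X)%VS]fixmx_proj.
rewrite fixmx_stable ?projmx_idem //; split=> [/map_mx_inj //|-> //].
Qed.

End Extension.

(** * Conjugation *)

Section Conjugation.

Variables (L : fieldType) (N : nat).
Implicit Types (u v g x : 'M[L]_N) (S : 'M[L]_N -> Prop).

Lemma conj_mxK u x : u \in unitmx -> invmx u *m (u *m x *m invmx u) *m u = x.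
Proof. by move=> uu; rewrite !mulmxA mulVmx // mul1mx -mulmxA mulVmx // mulmx1. Qed.

Lemma conj_mxVK u x : u \in unitmx -> u *m (invmx u *m x *m u) *m invmx u = x.
Proof. by move=> uu; rewrite !mulmxA mulmxV // mul1mx -mulmxA mulmxV // mulmx1. Qed.

Lemma conj_mxM u x y : u \in unitmx ->
  invmx u *m (x *m y) *m u = (invmx u *m x *m u) *m (invmx u *m y *m u).
Proof. by move=> uu; rewrite !mulmxA -(mulmxA _ u) mulmxV // mulmx1. Qed.

Lemma unitmx_conj u x : u \in unitmx -> (invmx u *m x *m u \in unitmx) = (x \in unitmx).
Proof. by move=> uu; rewrite !unitmx_mul unitmx_inv uu /= andbT. Qed.

Lemma invmxM u v : u \in unitmx -> v \in unitmx ->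
  invmx (u *m v) = invmx v *m invmx u.
Proof.
move=> uu vu; have uvu : u *m v \in unitmx by rewrite unitmx_mul uu.
apply: (can_inj (mulKmx uvu)).
by rewrite mulmxV // mulmxA -(mulmxA u) mulmxV // mulmx1 mulmxV.
Qed.

Lemma conj_mxV u x : u \in unitmx -> x \in unitmx ->
  invmx u *m invmx x *m u = invmx (invmx u *m x *m u).
Proof.
by move=> uu xu; rewrite !invmxM ?unitmx_mul ?unitmx_inv ?uu // invmxK mulmxA.
Qed.

Lemma conj_setP u S x : u \in unitmx -> conj_set u S x <-> S (invmx u *m x *m u).
Proof.
move=> uu; split=> [[y Sy ->]|Sx]; first by rewrite conj_mxK.
by exists (invmx u *m x *m u); rewrite ?conj_mxVK.
Qed.

Lemma conj_set_mul u v S : u \in unitmx -> v \in unitmx ->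
  conj_set u (conj_set v S) = conj_set (u *m v) S.
Proof.
move=> uu vu; apply: same_setE => x.
by rewrite !conj_setP ?unitmx_mul ?uu // invmxM // !mulmxA.
Qed.

Lemma conj_setK u S : u \in unitmx -> conj_set (invmx u) (conj_set u S) = S.
Proof.
move=> uu; apply: same_setE => x.
by rewrite !conj_setP ?unitmx_inv // invmxK conj_mxK.
Qed.

Lemma conj_setVK u S : u \in unitmx -> conj_set u (conj_set (invmx u) S) = S.
Proof.
by move=> uu; rewrite -{1}(invmxK u) conj_setK ?unitmx_inv.
Qed.

Lemma conj_set1 S : conj_set 1%:M S = S.
Proof.
apply: same_setE => x.
by rewrite conj_setP ?unitmx1 // mulmx1 -{1}(mulmx1 (invmx _)) mulVmx ?unitmx1 ?mul1mx.
Qed.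

Lemma conj_subset u S1 S2 : subset_of S1 S2 -> subset_of (conj_set u S1) (conj_set u S2).
Proof. by move=> S12 _ [y /S12 Sy ->]; exists y. Qed.

Lemma conj_subgroup u S : u \in unitmx -> subgroup S -> subgroup (conj_set u S).
Proof.
move=> uu [SGL S1 SM SV]; split.
- by move=> g /conj_setP -/(_ uu) /SGL; rewrite /GL unitmx_conj.
- by apply/conj_setP; rewrite // mulmx1 mulVmx.
- move=> g h /conj_setP -/(_ uu) Sg /conj_setP -/(_ uu) Sh.
  by apply/conj_setP; rewrite // conj_mxM //; apply: SM.
- move=> g /conj_setP -/(_ uu) Sg; apply/conj_setP; rewrite // conj_mxV //; first exact: SV.
  by rewrite -(unitmx_conj _ uu); apply: SGL.
Qed.

Lemma conj_self u S : subgroup S -> S u -> conj_set u S = S.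
Proof.
move=> [SGL S1 SM SV] Su; have uu := SGL u Su.
apply: same_setE => x; rewrite conj_setP //; split=> Sx.
  by rewrite -(conj_mxVK x uu); do 2?[apply: (SM)] => //; apply: SV.
by do 2?[apply: (SM)] => //; apply: SV.
Qed.

Lemma derived_conj u S1 S2 : u \in unitmx ->
  subset_of S1 (conj_set u S2) -> subset_of S1 (@GL L N) ->
  subset_of (derived S1) (conj_set u (derived S2)).
Proof.
(* For a subgroup [H] containing the commutators of [S2], the conjugate of [H] is a subgroup
   containing those of [S1]. *)
move=> uu S12 S1GL x S1x; apply/conj_setP => // H Hg HS2; apply/conj_setP => //.
apply: S1x; first exact: conj_subgroup.
move=> _ [g [h [S1g S1h ->]]]; apply/conj_setP => //; apply: HS2.
have gu := S1GL g S1g; have hu := S1GL h S1h.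
exists (invmx u *m g *m u), (invmx u *m h *m u); split.
- by apply/conj_setP => //; apply: S12.
- by apply/conj_setP => //; apply: S12.
by rewrite -!conj_mxV // -!conj_mxM.
Qed.

Lemma subgroup_GL : subgroup (@GL L N).
Proof.
split=> //; first exact: unitmx1.
  by move=> g h gu hu; rewrite /GL unitmx_mul gu.
by move=> g gu; rewrite /GL unitmx_inv.
Qed.

Lemma derived_GL S : subset_of S (@GL L N) -> subset_of (derived S) (@GL L N).
Proof.
move=> SGL x; apply; first exact: subgroup_GL.
move=> _ [g [h [/SGL gu /SGL hu ->]]].
by rewrite /GL !unitmx_mul !unitmx_inv gu hu.
Qed.

Lemma conj_solvable u S : u \in unitmx -> subset_of S (@GL L N) ->
  solvable S -> solvable (conj_set u S).
Proof.
move=> uu SGL [m triv]; exists m => x.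
have conjGL : subset_of (conj_set u S) (@GL L N).
  by move=> g /conj_setP -/(_ uu) /SGL; rewrite /GL unitmx_conj.
(* Invertibility is carried through the induction because [derived_conj] asks for it at every
   stage. *)
suff [H _] : subset_of (iter m (@derived L N) (conj_set u S))
                 (conj_set u (iter m (@derived L N) S)) /\
      subset_of (iter m (@derived L N) (conj_set u S)) (@GL L N).
  move/H/(conj_setP _ _ uu)/triv/(congr1 (fun y => u *m y *m invmx u)).
  by rewrite conj_mxVK // mulmx1 mulmxV.
elim: m {triv} => [|m [IH1 IH2]] /=; split=> //; last exact: derived_GL.
exact: derived_conj.
Qed.

Lemma closed_conj (F : fieldType) (iota : {rmorphism F -> L}) (u : 'M[F]_N) S :
  u \in unitmx -> subset_of S (@GL L N) -> closed_over iota S ->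
  closed_over iota (conj_set (map_mx iota u) S).
Proof.
move=> uu SGL Scl; have iuu : map_mx iota u \in unitmx by rewrite map_unitmx.
have -> : conj_set (map_mx iota u) S =
  (fun x => GL x /\ S (map_mx iota (invmx u) *m x *m map_mx iota u)).
  apply: same_setE => x; rewrite conj_setP // map_invmx; split=> [Sx|[]//].
  by split=> //; rewrite /GL -(unitmx_conj _ iuu); apply: SGL.
apply: closed_preimage => //; first exact: closed_GL.
  do 2?[apply: regular_mx_mul]; last exact: regular_mx_const.
    exact: regular_mx_const.
  exact: regular_mx_id.
by move=> g gu; rewrite map_invmx unitmx_conj.
Qed.

Lemma conj_alg_subgroup (F : fieldType) (iota : {rmorphism F -> L}) (u : 'M[F]_N) S :
  u \in unitmx -> alg_subgroup iota S ->
  alg_subgroup iota (conj_set (map_mx iota u) S).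
Proof.
move=> uu [Sg Scl]; split; first by apply: conj_subgroup; rewrite // map_unitmx.
by apply: closed_conj => //; case: Sg.
Qed.

End Conjugation.

(** * Conjugates of Borel and parabolic subgroups *)

Section ConjugationBorel.

Variables (K : closedFieldType) (N : nat).
Implicit Types (u : 'M[K]_N) (G S : 'M[K]_N -> Prop).

Lemma zclosed_conj u S : u \in unitmx -> subset_of S (@GL K N) ->
  zclosed S -> zclosed (conj_set u S).
Proof.
move=> uu SGL Scl.
by have := closed_conj uu SGL Scl; rewrite map_mx_id.
Qed.

Lemma zclosed_GL S : zclosed S -> subset_of S (@GL K N).
Proof. by case=> I SI g /SI[]. Qed.

Lemma conj_zclosed_subgroup u S : u \in unitmx ->
  zclosed_subgroup S -> zclosed_subgroup (conj_set u S).
Proof.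
move=> uu Salg.
by have := conj_alg_subgroup uu Salg; rewrite map_mx_id.
Qed.

(** A separation of the conjugate by closed sets is carried back to [S] by the inverse conjugation,
    which preserves closed sets. *)
Lemma conj_connected u S : u \in unitmx -> connected S -> connected (conj_set u S).
Proof.
move=> uu Sconn A1 A2 A1cl A2cl cover disj.
have uVu : invmx u \in unitmx by rewrite unitmx_inv.
have conjV A : subset_of S (conj_set (invmx u) A) -> subset_of (conj_set u S) A.
  by move/(conj_subset (u := u)); rewrite conj_setVK.
have pt g : S g -> conj_set u S (u *m g *m invmx u) by exists g.
have conjP A g : conj_set (invmx u) A g <-> A (u *m g *m invmx u).
  by rewrite conj_setP // invmxK.
suff [] : subset_of S (conj_set (invmx u) A1) \/ subset_of S (conj_set (invmx u) A2).
- by move/conjV; left.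
- by move/conjV; right.
apply: Sconn; try by apply: zclosed_conj => //; apply: zclosed_GL.
- by move=> g /pt /cover; rewrite !conjP.
- by move=> g /pt Sg; rewrite !conjP; apply: disj.
Qed.

Lemma conj_borel u G B : subgroup G -> G u -> borel G B -> borel G (conj_set u B).
Proof.
move=> Gg Gu [Bcl Bconn Bsolv BG Bmax].
have uu : u \in unitmx by case: Gg => GGL _ _ _; apply: GGL.
have uVu : invmx u \in unitmx by rewrite unitmx_inv.
have GV : G (invmx u) by case: Gg => _ _ _; apply.
split.
- exact: conj_zclosed_subgroup.
- exact: conj_connected.
- by apply: conj_solvable => //; case: Bcl => [[]].
- by rewrite -(conj_self Gg Gu); apply: conj_subset.
move=> S Scl Sconn Ssolv SG BS.
rewrite -(conj_setVK S uu); apply/conj_subset/Bmax.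
- exact: conj_zclosed_subgroup.
- exact: conj_connected.
- by apply: conj_solvable => //; case: Scl => [[]].
- by rewrite -(conj_self Gg GV); apply: conj_subset.
- by rewrite -(conj_setK B uu); apply: conj_subset.
Qed.

End ConjugationBorel.

Section ConjugationParabolic.

Variables (k : fieldType) (K : closedFieldType) (iota : {rmorphism k -> K}) (N : nat).
Implicit Types (u : 'M[k]_N) (G P : 'M[K]_N -> Prop).

Lemma kpoint_unit G u : subgroup G -> kpoint iota G u -> u \in unitmx.
Proof. by move=> [GGL _ _ _] /GGL; rewrite /GL map_unitmx. Qed.

Lemma kpoint1 G : subgroup G -> kpoint iota G 1%:M.
Proof. by case=> _ G1 _ _; rewrite /kpoint map_mx1. Qed.

Lemma kpointM G (u v : 'M[k]_N) : subgroup G -> kpoint iota G u -> kpoint iota G v ->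
  kpoint iota G (u *m v).
Proof. by case=> _ _ GM _ Gu Gv; rewrite /kpoint map_mxM; apply: GM. Qed.

Lemma kpointV G u : subgroup G -> kpoint iota G u -> kpoint iota G (invmx u).
Proof. by case=> _ _ _ GV Gu; rewrite /kpoint map_invmx; apply: GV. Qed.

Lemma conj_parabolic G P u : subgroup G -> kpoint iota G u ->
  parabolic iota G P -> parabolic iota G (conj_set (map_mx iota u) P).
Proof.
move=> Gg Gu [Palg PG [B0 B0b B0P]]; split.
- by apply: conj_alg_subgroup => //; apply: kpoint_unit Gu.
- by rewrite -(conj_self Gg Gu); apply: conj_subset.
- by exists (conj_set (map_mx iota u) B0); [apply: conj_borel|apply: conj_subset].
Qed.

Lemma conj_max_parabolic G P u : subgroup G -> kpoint iota G u ->
  max_parabolic iota G P -> max_parabolic iota G (conj_set (map_mx iota u) P).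
Proof.
move=> Gg Gu [Ppar Pprop Pmax].
have uu : map_mx iota u \in unitmx by rewrite map_unitmx (kpoint_unit Gg Gu).
have GuV := kpointV Gg Gu; have GV := GuV; rewrite /kpoint map_invmx in GV.
split; first exact: conj_parabolic.
  move/(conj_subset (u := invmx (map_mx iota u))).
  by rewrite conj_setK // (conj_self Gg GV).
move=> Q Qpar Qprop PQ; rewrite -(conj_setVK Q uu); apply/conj_subset/Pmax.
- by rewrite -map_invmx; apply: conj_parabolic.
- move/(conj_subset (u := map_mx iota u)).
  by rewrite conj_setVK // (conj_self Gg Gu).
- by rewrite -(conj_setK P uu); apply: conj_subset.
Qed.

End ConjugationParabolic.

(** * Density of rational points *)

Section Density.

Variables (k : fieldType) (K : closedFieldType) (iota : {rmorphism k -> K}).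
Hypothesis char0 : [pchar k] =i pred0.
Local Notation idK := (idfun : {rmorphism K -> K}).

Lemma natr_inj_char0 : injective (fun n => n%:R : k).
Proof.
have natr_eq0 := (pcharf0P k).1 char0.
have lt_neq i j : (i < j)%N -> i%:R <> j%:R :> k.
  move=> ltij /esym/eqP; rewrite -subr_eq0 -natrB ?(ltnW ltij) // natr_eq0.
  by rewrite subn_eq0 leqNgt ltij.
by move=> i j eqij; case: (ltngtP i j) => // /lt_neq; rewrite eqij.
Qed.

Lemma poly_eq0_char0 (r : {poly K}) :
  (forall c : k, c != 0 -> r.[iota c] = 0) -> r = 0.
Proof.
move=> r0; apply/eqP/negP => /negP rn0.
(* The integers 1, ..., [size r] are distinct roots, more than the degree allows; starting at 1
   avoids the excluded point 0. *)
pose s := [seq iota (j.+1%:R : k) | j <- seq.iota 0 (size r)].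
have : (size s < size r)%N.
  apply: max_poly_roots => //.
    by apply/allP => _ /mapP[j _ ->]; apply/rootP/r0; rewrite ((pcharf0P k).1 char0).
  by rewrite map_inj_uniq ?iota_uniq // => i j /fmorph_inj /natr_inj_char0[].
by rewrite size_map size_iota ltnn.
Qed.

Lemma regular_base_change N (f : 'M[K]_N -> K) : regular iota f -> regular idK f.
Proof.
move=> [q [e fE]]; exists (map_mpoly iota q), e => g gu.
by rewrite mmap_map_mpoly fE.
Qed.

(** A polynomial equation restricted to the polynomial curve [M] becomes a polynomial in one
    variable, to which [poly_eq0_char0] applies. *)
Lemma mmap_horner N (M : 'M[{poly K}]_N) (q : {mpoly K[N * N]}) t :
  (mmap (polyC : {rmorphism K -> {poly K}}) (mxvec M 0) q).[t] =
  mmap idK (mxcoord (map_mx (horner_eval t) M)) q.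
Proof.
rewrite /mmap horner_sum; apply: eq_bigr => m _; rewrite hornerM hornerC /mmap1.
rewrite horner_prod; congr (_ * _); apply: eq_bigr => l _.
by rewrite horner_exp /mxcoord -map_mxvec mxE.
Qed.

Lemma curve_vanish N (M : 'M[{poly K}]_N) (q : {mpoly K[N * N]}) :
  (forall c : k, c != 0 ->
     mmap idK (mxcoord (map_mx (horner_eval (iota c)) M)) q = 0) ->
  forall t, mmap idK (mxcoord (map_mx (horner_eval t) M)) q = 0.
Proof.
move=> q0 t; rewrite -mmap_horner [mmap _ _ _]poly_eq0_char0 ?horner0 // => c cn0.
by rewrite mmap_horner q0.
Qed.

Lemma Ga_evalE N (x : 'M[{poly k}]_N) t :
  Ga_eval iota x t = map_mx (horner_eval t) (map_mx (map_poly iota) x).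
Proof. by apply/matrixP => i j; rewrite !mxE. Qed.

Lemma Ga_eval_rat N (x : 'M[{poly k}]_N) c :
  Ga_eval iota x (iota c) = map_mx iota (map_mx (fun p => p.[c]) x).
Proof. by apply/matrixP => i j; rewrite !mxE horner_map. Qed.

Lemma Ga_dense N (x : 'M[{poly k}]_N) (S : 'M[K]_N -> Prop) :
  zclosed S -> (forall t, Ga_eval iota x t \in unitmx) ->
  (forall c, S (Ga_eval iota x (iota c))) -> forall t, S (Ga_eval iota x t).
Proof.
move=> [I SI] xu Sk t; apply/SI; split=> // p Ip; rewrite Ga_evalE.
apply: curve_vanish => c _; rewrite -Ga_evalE.
by have [_ ->] := (SI _).1 (Sk c).
Qed.

(** The coordinates are freed from rationality one at a time, each by a one-variable density
    argument. *)
Lemma torus_dense N n (tau : regmap k n N) (S : 'M[K]_N -> Prop) :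
  zclosed S ->
  (forall s : 'rV[K]_n, (forall i, s 0 i != 0) -> torus_pt iota tau s \in unitmx) ->
  (forall s : 'rV[k]_n, (forall i, s 0 i != 0) ->
     S (torus_pt iota tau (map_mx iota s))) ->
  forall s : 'rV[K]_n, (forall i, s 0 i != 0) -> S (torus_pt iota tau s).
Proof.
move=> [I SI] tauu Sk.
have diagu (s : 'rV[K]_n) : (forall i, s 0 i != 0) -> diag_mx s \in unitmx.
  by move=> s0; rewrite unitmxE det_diag unitfE; apply/prodf_neq0 => i _.
(* Coordinates of index at least [j] are rational and the others arbitrary nonzero: [j] = 0 is the
   hypothesis, [j] = n the goal. *)
suff H j (s : 'rV[K]_n) : (forall i, s 0 i != 0) ->
    (forall i : 'I_n, (j <= i)%N -> exists c, s 0 i = iota c) -> S (torus_pt iota tau s).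
  by move=> s s0; apply: (H n) => // i; rewrite leqNgt ltn_ord.
elim: j s => [|j IHj] s s0 sk.
  have [c cE] := fin_all_exists (fun i => sk i (leq0n i)).
  have -> : s = map_mx iota (\row_i c i) by apply/rowP => i; rewrite !mxE.
  by apply: Sk => i; rewrite mxE -(fmorph_eq0 iota) -cE.
have [ltjn|lenj] := ltnP j n; last first.
  by apply: IHj => // i ji; have := ltn_ord i; rewrite ltnNge (leq_trans lenj ji).
pose l := Ordinal ltjn.
(* The coordinate [l] becomes a variable. The curve passes through [s], and at nonzero rational
   parameters the induction hypothesis applies. *)
pose sX : 'rV[{poly K}]_n := \row_i if i == l then 'X else (s 0 i)%:P.
pose st t : 'rV[K]_n := \row_i if i == l then t else s 0 i.
have stE t : map_mx (horner_eval t) (diag_mx sX) = diag_mx (st t).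
  rewrite map_diag_mx; congr diag_mx; apply/rowP => i; rewrite !mxE /=.
  by case: ifP => _; rewrite /horner_eval ?hornerX ?hornerC.
have st0 t : t != 0 -> forall i, st t 0 i != 0.
  by move=> tn0 i; rewrite mxE; case: ifP.
have <- : st (s 0 l) = s.
  by apply/rowP => i; rewrite mxE; case: eqP => // ->.
apply/SI; split; first exact/tauu/st0.
move=> p Ip.
have [q [e qE]] : regular idK (fun g => mmap idK (mxcoord (regeval iota tau g)) p).
  by apply: regular_poly => i i'; apply/regular_base_change/regular_mx_eval.
have stu t : t != 0 -> diag_mx (st t) \in unitmx by move=> tn0; apply/diagu/st0.
(* Since [tau] may have a denominator, vanishing is proved for the numerator [q]; the denominator is
   nonzero as long as the parameter is. *)
rewrite /torus_pt qE ?stu // -stE (@curve_vanish _ _ q) ?mulr0 // => c cn0.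
have icn0 : iota c != 0 by rewrite fmorph_eq0.
have /SI[_ /(_ p Ip)] : S (torus_pt iota tau (st (iota c))).
  apply: IHj; first exact: st0.
  move=> i ji; rewrite mxE; case: eqP => [_|/eqP nil]; first by exists c.
  apply: sk; rewrite ltn_neqAle ji andbT eq_sym.
  by apply: contra nil => /eqP ij; apply/eqP/val_inj.
rewrite /torus_pt qE ?stu // stE => /eqP; rewrite mulf_eq0 expf_eq0 invr_eq0.
by have := stu _ icn0; rewrite unitmxE unitfE => /negbTE ->; rewrite andbF => /eqP.
Qed.

Lemma zgenerated_sub N (A : 'M[K]_N -> Prop) : subset_of A (zgenerated A).
Proof. by move=> g Ag H _; apply. Qed.

(** By the universal property of [zgenerated], used for the parabolic and then for [B], only torus
    elements and root groups need be checked; these are parametrized over [k]. *)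
Lemma std_parabolic_dense N n (G T B : 'M[K]_N -> Prop) (tau : regmap k n N)
    (Delta : 'I_n -> 'rV[int]_n) (i : 'I_n) (H : 'M[K]_N -> Prop) :
  subset_of G (@GL K N) -> split_torus iota T tau -> subset_of T B ->
  simple_roots_of iota G tau B T Delta -> zclosed_subgroup H ->
  (forall g : 'M[k]_N, std_parabolic iota G tau B Delta i (map_mx iota g) ->
     H (map_mx iota g)) ->
  subset_of (std_parabolic iota G tau B Delta i) H.
Proof.
move=> GGL [[[TGL _ _ _] _] [[tauT _] [tauV [tauVT _ tauK]]]] TB [_ BE] HH Hk.
have [_ Hcl] := HH.
have root_sub a : subset_of (root_group iota G tau a)
    (std_parabolic iota G tau B Delta i) -> subset_of (root_group iota G tau a) H.
  move=> aP _ [x [c [xa ->]]]; have [xG _ _ _] := xa.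
  apply: Ga_dense => // [t|{}c]; first exact: GGL.
  by rewrite Ga_eval_rat; apply: Hk; rewrite -Ga_eval_rat; apply: aP; exists x, (iota c).
have BP : subset_of B (std_parabolic iota G tau B Delta i).
  by move=> g Bg; apply: zgenerated_sub; left.
move=> g; apply=> // {}g [|[j nji ag]]; last first.
  by apply: (root_sub (- Delta j)) => // h ah; apply: zgenerated_sub; right; exists j.
move/BE; apply=> // {}g [Tg|[a apos ag]]; last first.
  apply: (root_sub a) => // h ah; apply: BP; apply: (BE h).2; refine (zgenerated_sub _).
  by right; exists a.
have tauTT (s : 'rV[K]_n) : (forall i, s 0 i != 0) -> T (torus_pt iota tau s).
  by move=> s0; apply: tauT; exists s.
rewrite -(tauK g Tg); have [s [s0 ->]] := tauVT g Tg.
apply: torus_dense => // {s0} s s0; first exact/TGL/tauTT.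
(* At rational parameters the torus point is a k-point of the parabolic, so it lies in [H]. *)
rewrite /torus_pt -map_diag_mx -map_regeval; apply: Hk.
rewrite map_regeval map_diag_mx; apply: BP; apply: TB; apply: (tauTT (map_mx iota s)) => l.
by rewrite mxE fmorph_eq0.
Qed.

End Density.

(** * Homomorphisms and stabilizers *)

Section Homomorphisms.

Variables (F L : fieldType) (iota : {rmorphism F -> L}) (N M : nat).
Variables (S1 : 'M[L]_N -> Prop) (S2 : 'M[L]_M -> Prop) (f : regmap F N M).
Hypotheses (S1g : subgroup S1) (S2GL : subset_of S2 (@GL L M)).
Hypothesis (fhom : alg_hom iota S1 S2 f).

Lemma alg_hom_unit g : S1 g -> regeval iota f g \in unitmx.
Proof. by case: fhom => fS _ /fS /S2GL. Qed.

Lemma alg_hom1 : regeval iota f 1%:M = 1%:M.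
Proof.
have [_ S11 _ _] := S1g; have [_ fM] := fhom.
have := fM _ _ S11 S11; rewrite mulmx1 => /(congr1 (mulmx (invmx (regeval iota f 1%:M)))).
by rewrite mulKmx ?mulVmx ?alg_hom_unit.
Qed.

Lemma alg_homV g : S1 g -> regeval iota f (invmx g) = invmx (regeval iota f g).
Proof.
move=> Sg; have [S1GL _ _ S1V] := S1g; have [_ fM] := fhom.
apply: (can_inj (mulKmx (alg_hom_unit Sg))).
by rewrite -fM ?mulmxV ?alg_hom1 ?alg_hom_unit //; (exact: S1V || exact: S1GL).
Qed.

Lemma morph_image_conj P g : subset_of P S1 -> S1 g ->
  morph_image iota f (conj_set g P) = conj_set (regeval iota f g) (morph_image iota f P).
Proof.
move=> PS Sg; have [_ _ SM SV] := S1g; have [_ fM] := fhom.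
have fconj p : P p -> regeval iota f (g *m p *m invmx g) =
    regeval iota f g *m regeval iota f p *m invmx (regeval iota f g).
  move=> /PS Sp; rewrite fM ?fM ?alg_homV //; first exact: SM.
  exact: SV.
apply: same_setE => x; split.
  by move=> [_ [p Pp ->] ->]; exists (regeval iota f p); [exists p | apply: fconj].
by move=> [_ [p Pp ->] ->]; exists (g *m p *m invmx g); [exists p | rewrite fconj].
Qed.

Lemma alg_subgroup_preimage S : closed_over iota S1 -> alg_subgroup iota S ->
  alg_subgroup iota (fun g => S1 g /\ S (regeval iota f g)).
Proof.
move=> S1cl [[SGL S1' SM SV] Scl]; have [S1GL S11 S1M S1V] := S1g.
have [_ fM] := fhom.
split; last by apply: closed_preimage => //; [apply: regular_mx_eval | apply: alg_hom_unit].
split.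
- by move=> g [/S1GL].
- by rewrite alg_hom1.
- by move=> g h [Sg Sfg] [Sh Sfh]; split; [apply: S1M | rewrite fM //; apply: SM].
- by move=> g [Sg Sfg]; split; [apply: S1V | rewrite alg_homV //; apply: SV].
Qed.

End Homomorphisms.

(** * Stabilizers of subspaces and maximal parabolics *)

Section Stabilizers.

Variables (k : fieldType) (K : closedFieldType) (iota : {rmorphism k -> K}).
Variables (N d : nat) (G : 'M[K]_N -> Prop) (rho : regmap k N d).
Hypotheses (Galg : alg_subgroup iota G) (hrho : representation iota G rho).

Let Gg : subgroup G := proj1 Galg.
Let idk := (idfun : {rmorphism k -> k}).

Definition stabilizer (W : {vspace 'cV[k]_d}) (g : 'M[K]_N) : Prop :=
  G g /\ (mx_act (regeval iota rho g) (extend iota W) <= extend iota W)%VS.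

Lemma alg_subgroup_linear_stabilizer (W : {vspace 'cV[k]_d}) :
  alg_subgroup iota
    (fun A : 'M[K]_d => GL A /\ (mx_act A (extend iota W) <= extend iota W)%VS).
Proof.
split.
  split=> [A []//||A B [Au AW] [Bu BW]|A [Au AW]].
  - by split; [exact: unitmx1 | rewrite mx_act1].
  - split; first by rewrite /GL unitmx_mul Au.
    by rewrite -mx_actM (subv_trans _ AW) // limgS.
  (* Equality of dimensions turns AW inside W into AW = W, whence stability under the inverse. *)
  - split; first by rewrite /GL unitmx_inv.
    by rewrite -{1}(mx_act_stable Au AW) mx_actK.
(* Stability reads (1 - Q)AQ = 0, a system of linear equations in A with coefficients in [k]. *)
set Q := map_mx iota (projmx W); set Q' := map_mx iota (1%:M - projmx W).
pose J h := exists i j, h = fun A : 'M[K]_d => (Q' *m A *m Q) i j.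
have regJ h : J h -> regular iota h.
  move=> [i [j ->]]; have regQ P := @regular_mx_const _ _ iota d d P.
  exact: (regular_mx_mul (regular_mx_mul (regQ _) (@regular_mx_id _ _ iota d)) (regQ _)).
apply: (closed_over_regular regJ) => A.
have Q'E : Q' *m A *m Q = A *m Q - Q *m A *m Q.
  by rewrite /Q' map_mxB map_mx1 !mulmxBl mul1mx.
rewrite extend_stable -/Q; split=> -[Au H]; split=> //.
  by move=> _ [i [j ->]]; rewrite Q'E H subrr mxE.
apply/esym/eqP; rewrite -subr_eq0 -Q'E; apply/eqP/matrixP => i j; rewrite [RHS]mxE.
by apply: (H (fun A => (Q' *m A *m Q) i j)); exists i, j.
Qed.

Lemma alg_subgroup_stabilizer W : alg_subgroup iota (stabilizer W).
Proof.
have -> : stabilizer W = fun g => G g /\ (GL (regeval iota rho g) /\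
    (mx_act (regeval iota rho g) (extend iota W) <= extend iota W)%VS).
  apply: same_setE => g; split=> [[Gg' gW]|[? []//]]; split=> //; split=> //.
  exact: (alg_hom_unit _ hrho).
have [_ Gcl] := Galg.
exact: (alg_subgroup_preimage Gg _ hrho Gcl (alg_subgroup_linear_stabilizer W)).
Qed.

(** The stabilizer is parabolic, as it contains a Borel subgroup of [P], and proper by
    irreducibility; maximality of [P] gives the equality. *)
Lemma max_parabolic_stabilizer W P :
  irreducible_rep iota G rho -> W <> 0%VS -> W <> fullv ->
  max_parabolic iota G P -> stabilized_by iota rho P W -> P = stabilizer W.
Proof.
move=> [_ irr] W0 W1 [[Palg PG [B0 B0b B0P]] Pprop Pmax] PW.
have PS : subset_of P (stabilizer W) by move=> g Pg; split; [apply: PG | apply: PW].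
apply: same_setE => g; split; first exact: PS.
apply: (Pmax _ _ _ PS) => [|GS].
  split; [exact: alg_subgroup_stabilizer | by move=> h [] |].
  by exists B0 => // h /B0P /PS.
by have [] : W = 0%VS \/ W = fullv by apply: irr => h /GS[].
Qed.

Lemma regeval_ratM M (f : regmap k N M) (S : 'M[K]_M -> Prop) g h :
  alg_hom iota G S f -> kpoint iota G g -> kpoint iota G h ->
  regeval idk f (g *m h) = regeval idk f g *m regeval idk f h.
Proof.
move=> [_ fM] Gg' Gh; apply: (map_mx_inj (f := iota)).
by rewrite map_mxM !map_regeval map_mxM fM.
Qed.

Lemma kpoint_regeval M (f : regmap k N M) (S : 'M[K]_M -> Prop) g :
  alg_hom iota G S f -> kpoint iota G g -> kpoint iota S (regeval idk f g).
Proof. by move=> [fS _] Gg'; rewrite /kpoint map_regeval; apply: fS. Qed.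

Lemma gactM g h W : kpoint iota G g -> kpoint iota G h ->
  gact rho (g *m h) W = gact rho g (gact rho h W).
Proof. by move=> Gg' Gh; rewrite /gact mx_actM (regeval_ratM hrho). Qed.

Lemma gact1 W : gact rho 1%:M W = W.
Proof.
rewrite /gact (_ : regeval _ _ _ = 1%:M) ?mx_act1 //.
apply: (map_mx_inj (f := iota)).
by rewrite map_regeval !map_mx1 (alg_hom1 Gg _ hrho).
Qed.

Lemma gactK g W : kpoint iota G g -> gact rho (invmx g) (gact rho g W) = W.
Proof.
move=> Gg'; rewrite -gactM ?mulVmx ?gact1 ?(kpoint_unit Gg Gg') //.
exact: kpointV.
Qed.

(** This translates between parabolics, which are sets of K-points, and the action of G(k) in which
    the equivariance of [psi] is phrased. *)
Lemma stabilizer_kpoint W g : kpoint iota G g ->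
  stabilizer W (map_mx iota g) <-> gact rho g W = W.
Proof.
move=> Gg'; have gu : regeval idk rho g \in unitmx.
  by have := kpoint_regeval hrho Gg'; rewrite /kpoint /GL map_unitmx.
rewrite /stabilizer -map_regeval extend_stable_map; split=> [[_]|gW].
  exact: mx_act_stable.
by split=> //; rewrite -[mx_act _ _]/(gact rho g W) gW.
Qed.

End Stabilizers.

Lemma morph_image_max_parabolic (k : fieldType) (K : closedFieldType)
    (iota : {rmorphism k -> K}) N (G P Q : 'M[K]_N -> Prop) (phi : regmap k N N) :
  alg_subgroup iota G -> alg_iso iota G G phi ->
  max_parabolic iota G P -> max_parabolic iota G Q ->
  (forall H : 'M[K]_N -> Prop, zclosed_subgroup H ->
     (forall p : 'M[k]_N, P (map_mx iota p) -> H (map_mx iota p)) -> subset_of P H) ->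
  (forall p : 'M[k]_N, P (map_mx iota p) ->
     Q (map_mx iota (regeval (idfun : {rmorphism k -> k}) phi p))) ->
  morph_image iota phi P = Q.
Proof.
move=> Galg [phihom [phiV [phiVG _ phiK]]] [[_ PG [B0 B0b B0P]] _ Pmax]
  [[Qalg QG _] Qprop _] Pdense PQ.
have [Gg Gcl] := Galg; have GGL : subset_of G (@GL K N) by case: Gg.
pose H g := G g /\ Q (regeval iota phi g).
have Halg : alg_subgroup iota H by apply: (alg_subgroup_preimage Gg GGL phihom).
have PH : subset_of P H.
  apply: Pdense; first exact: alg_subgroup_base_change Halg.
  by move=> p Pp; split; [apply: PG | rewrite -map_regeval; apply: PQ].
have HP : subset_of H P.
  apply: (Pmax _ _ _ PH) => [|GH].
    split=> // [g []//|]; by exists B0 => // g /B0P /PH.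
  (* If the preimage of [Q] were all of [G], surjectivity of [phi] would force [Q] to contain
     [G]. *)
  by apply: Qprop => g Gx; rewrite -(phiK g Gx); have [] := GH _ (phiVG g Gx).
apply: same_setE => x; split=> [[p /PH[_ Qp] ->] //|Qx].
have Gx := QG x Qx; exists (regeval iota phiV x); last by rewrite phiK.
by apply: HP; split; [apply: phiVG | rewrite phiK].
Qed.

(** * Identification of [psi] with the induced automorphism *)

Theorem theorem10p1
  (k : fieldType) (char0 : [pchar k] =i pred0)
  (K : closedFieldType) (iota : {rmorphism k -> K})
  (* G, split simply connected semisimple over k, of rank n *)
  (N n : nat) (G T B : 'M[K]_N -> Prop) (tau : regmap k n N)
  (Delta : 'I_n -> 'rV[int]_n)
  (hG : alg_subgroup iota G) (Gss : semisimple G) (Gsc : simply_connected G)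
  (Tsplit : split_torus iota T tau) (Tmax : maximal_torus G T)
  (hB : borel G B) (Bk : alg_subgroup iota B) (TB : subset_of T B)
  (hDelta : simple_roots_of iota G tau B T Delta)
  (* V = k^d, nontrivial irreducible *)
  (d : nat) (rho : regmap k N d)
  (hrho : representation iota G rho) (rho_irr : irreducible_rep iota G rho)
  (rho_nt : nontrivial_rep iota G rho)
  (* the chosen P_delta-invariant subspaces V_delta *)
  (Vst : 'I_n -> {vspace 'cV[k]_d})
  (Vst_neq0 : forall i, Vst i <> 0%VS) (Vst_proper : forall i, Vst i <> fullv)
  (Vst_inv : forall i,
     stabilized_by iota rho (std_parabolic iota G tau B Delta i) (Vst i))
  (phi : regmap k N N) (hphi : alg_iso iota G G phi)
  (psi : {vspace 'cV[k]_d} -> {vspace 'cV[k]_d})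
  (psi_equiv : forall (X : {vspace 'cV[k]_d}) (g : 'M[k]_N),
     Gamma_V iota G rho (std_parabolic iota G tau B Delta) Vst X ->
     kpoint iota G g ->
     psi (gact rho g X)
     = gact rho (regeval (idfun : {rmorphism k -> k}) phi g) (psi X))
  (psi_chamber : exists Vs : 'I_n -> {vspace 'cV[k]_d},
     chamber iota G rho (std_parabolic iota G tau B Delta) Vst
       (fun Y => exists i, Y = Vs i) /\
     chamber iota G rho (std_parabolic iota G tau B Delta) Vst
       (fun Y => exists i, Y = psi (Vs i))) :
  induced_by iota G rho (std_parabolic iota G tau B Delta) Vst phi psi.
Proof.
set Pst := std_parabolic iota G tau B Delta in Vst_inv psi_equiv psi_chamber *.
have Gg : subgroup G by case: hG.
have GGL : subset_of G (@GL K N) by case: Gg.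
have [phihom _] := hphi.
have [Vs [[X [Xtype _ VsX]] [Y [Ytype _ psiY]]]] := psi_chamber.
(* The chamber has an object of every type, hence a maximal parabolic conjugate to each [Pst i]. *)
have typed_pst i Z : has_type iota G rho Pst Vst i Z -> max_parabolic iota G (Pst i).
  move=> [P [Pmax [g [Gkg /same_setE PE _]]]].
  have gu : map_mx iota g \in unitmx by apply: GGL.
  rewrite -(conj_setK (Pst i) gu) -PE -map_invmx.
  exact: conj_max_parabolic (kpointV Gg Gkg) Pmax.
have Pmax i : max_parabolic iota G (Pst i) := typed_pst i _ (Xtype i).
have VstGamma i : Gamma_V iota G rho Pst Vst (Vst i).
  exists (Pst i), i; split; first exact: Pmax.
  exists 1%:M; split; [exact: kpoint1 | | by rewrite (gact1 hG hrho)].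
  by move=> g; rewrite map_mx1 conj_set1.
have psiVst i : exists j u, kpoint iota G u /\ psi (Vst i) = gact rho u (Vst j).
  have [g [Gkg XE]] : exists g, kpoint iota G g /\ X i = gact rho g (Vst i).
    by have [P [_ [g [Gkg _ XE]]]] := Xtype i; exists g.
  (* A chamber is an unindexed collection: [X i] is some [Vs a], and [psi (Vs a)] is an object of
     some type [j], possibly other than [i]. *)
  have [a XiE] := (VsX (X i)).2 (ex_intro _ i erefl).
  have [j psiE] := (psiY (psi (Vs a))).1 (ex_intro _ a erefl).
  have [_ [_ [h [Gkh _ YE]]]] := Ytype j.
  have GkgV := kpointV Gg Gkg; have GkphiV := kpoint_regeval phihom GkgV.
  (* With X_i = gV_i and psi(X_i) = hV_j, equivariance gives psi(V_i) = phi(g^-1)hV_j. *)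
  exists j, (regeval idfun phi (invmx g) *m h); split; first exact: kpointM.
  rewrite (gactM hrho) // -YE -psiE -XiE -psi_equiv //.
    by rewrite XE (gactK hG hrho).
  by have [P XP] := Xtype i; exists P, i.
have stabE i := max_parabolic_stabilizer hG hrho rho_irr (@Vst_neq0 i)
  (@Vst_proper i) (Pmax i) (@Vst_inv i).
move=> P' Z [i [_ [g [Gkg /same_setE -> ->]]]].
have [j [u [Gku psiE]]] := psiVst i.
have GuV := kpointV Gg Gku.
have uu := kpoint_unit Gg Gku; have iuu : map_mx iota u \in unitmx by apply: GGL.
have phiP : morph_image iota phi (Pst i) = conj_set (map_mx iota u) (Pst j).
  apply: (morph_image_max_parabolic hG hphi (Pmax i)
    (conj_max_parabolic Gg Gku (Pmax j))) => [H HH|].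
    exact: (std_parabolic_dense char0 GGL Tsplit TB hDelta HH).
  move=> p Pp; have Gkp : kpoint iota G p by have [[_ PG _] _ _] := Pmax i; apply: PG.
  have Gkphip := kpoint_regeval phihom Gkp.
  (* It suffices that u^-1 phi(p) u fixes V_j, which follows from phi(p)uV_j = phi(p)psi(V_i) =
     psi(pV_i) = psi(V_i) = uV_j. *)
  apply/conj_setP => //; rewrite -map_invmx -!map_mxM stabE.
  have Gkconj : kpoint iota G (invmx u *m regeval idfun phi p *m u).
    by do 2?[apply: kpointM => //].
  apply/(stabilizer_kpoint hrho _ Gkconj); rewrite -mulmxA.
  rewrite !(gactM hrho) //; last exact: kpointM.
  rewrite -psiE -psi_equiv //.
  have -> : gact rho p (Vst i) = Vst i.
    by apply/(stabilizer_kpoint hrho _ Gkp); rewrite -stabE.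
  by rewrite psiE (gactK hG hrho).
have Gkphi := kpoint_regeval phihom Gkg.
have PiG : subset_of (Pst i) G by case: (Pmax i) => [[]].
(* The single element phi(g)u carries P_j to phi(gP_i g^-1) and V_j to psi(gV_i). *)
exists j; rewrite (morph_image_conj Gg GGL phihom PiG Gkg) phiP -map_regeval.
rewrite conj_set_mul ?map_unitmx // ?(kpoint_unit Gg Gkphi) // -map_mxM.
split; first by apply: conj_max_parabolic => //; apply: kpointM.
exists (regeval idfun phi g *m u); split=> //; first exact: kpointM.
by rewrite psi_equiv // psiE (gactM hrho).
Qed.
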